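(* Let $X$ be an hls-space whose topology is Tychonoff, and for $Y\subseteq X$ let $\overline{Y}$ denote the closure of $Y$ in the Higson compactification $h(X)$. Then the following are equivalent: (1) $X$ is hls-normal; (2) any two disjoint closed subsets $A$ and $B$ of $X$ are coarsely separated if and only if $\overline{A} \cap \overline{B} = \varnothing$.
   Context: For $B\subseteq X$ and a family $\mathcal{U}$ of subsets of $X$, $\mathrm{st}(B,\mathcal{U})$ is the union of the elements of $\mathcal{U}$ meeting $B$; for a family $\mathcal{B}$, $\mathrm{st}(\mathcal{B},\mathcal{U})=\{\mathrm{st}(B,\mathcal{U})\mid B\in\mathcal{B}\}$. A large scale structure (ls-structure) on a set $X$ is a nonempty collection $\mathcal{L}$ of families of subsets of $X$ (the uniformly bounded families) such that: (i) if $\mathcal{B}_1\in\mathcal{L}$ and each element of $\mathcal{B}_2$ having more than one point is contained in some element of $\mathcal{B}_1$, then $\mathcal{B}_2\in\mathcal{L}$; (ii) $\mathcal{B}_1,\mathcal{B}_2\in\mathcal{L}$ implies $\mathrm{st}(\mathcal{B}_1,\mathcal{B}_2)\in\mathcal{L}$. A hybrid large scale space (hls-space) is a set with an ls-structure and a topology such that some uniformly bounded cover consists of open sets. A subset is bounded if it is an element of some uniformly bounded cover. The coarse component of a point $x$ is the union of all bounded sets containing $x$. A subset is weakly bounded if its intersection with every coarse component is bounded. A map $f:X\to M$ to a metric space is slowly oscillating if for every uniformly bounded family $\mathcal{U}$ and every $\varepsilon>0$ there is a weakly bounded set $K$ such that $\mathrm{diam}(f(U))<\varepsilon$ for every $U\in\mathcal{U}$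 with $U\cap K=\varnothing$. Subsets $A,B$ are coarsely separated if $\mathrm{st}(A,\mathcal{U})\cap\mathrm{st}(B,\mathcal{U})$ is weakly bounded for every uniformly bounded family $\mathcal{U}$. For an hls-space $X$ with Tychonoff (completely regular Hausdorff) topology, the Higson compactification $h(X)$ is the Hausdorff compactification of $X$ corresponding to the algebra of all continuous bounded slowly oscillating functions on $X$; i.e. the (unique up to equivalence) Hausdorff compactification such that a continuous function $f:X\to[0,1]$ extends continuously to $h(X)$ if and only if $f$ is slowly oscillating. $N$ is a coarse neighbourhood of $A$ if $A\subseteq N$ and for every uniformly bounded cover $\mathcal{U}$, $\mathrm{st}(A,\mathcal{U})\subseteq N\cup K$ for some weakly bounded $K$. $N$ is a topological neighbourhood of $A$ if $N$ contains an open set containing $\mathrm{cl}(A)$. $N$ is a hybrid neighbourhood of $A$ if it is both. An hls-space $X$ is hls-normal if for every closed $A\subseteq X$ and every hybrid neighbourhood $N$ of $A$ there is a closed $V\subseteq X$ such that $V$ is a hybrid neighbourhood of $A$ and $N$ is a hybrid neighbourhood of $V$. *)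

(* Defs.v *)
From HB Require Import structures.
From mathcomp Require Import all_boot all_order all_algebra.
From mathcomp Require Import all_classical all_reals all_analysis.

Set Implicit Arguments.
Unset Strict Implicit.
Unset Printing Implicit Defensive.

Import Order.TTheory GRing.Theory Num.Theory.
Import numFieldNormedType.Exports.

Local Open Scope classical_set_scope.
Local Open Scope ring_scope.

Section LargeScale.
Context {X : Type}.
Implicit Types (A B K N : set X) (U : set (set X)) (L : set (set (set X))).

Definition star B U : set X :=
  \bigcup_(A in [set A | U A /\ A `&` B !=set0]) A.

Definition star_family U1 U2 : set (set X) := [set star B U2 | B in U1].

Definition ls_structure L : Prop :=
  [/\ L !=set0,
      forall U1 U2, L U1 ->
        (forall B, U2 B -> (exists x y, [/\ B x, B y & x <> y]) ->
           exists2 A, U1 A & B `<=` A) ->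
        L U2
    & forall U1 U2, L U1 -> L U2 -> L (star_family U1 U2)].

Definition ub_cover L U : Prop := L U /\ cover U id = [set: X].

Definition bounded L B : Prop := exists2 U, ub_cover L U & U B.

Definition coarse_component L (x : X) : set X :=
  \bigcup_(B in [set B | bounded L B /\ B x]) B.

Definition weakly_bounded L K : Prop :=
  forall x, bounded L (K `&` coarse_component L x).

Definition coarsely_separated L A B : Prop :=
  forall U, L U -> weakly_bounded L (star A U `&` star B U).

Definition coarse_nbhd L A N : Prop :=
  A `<=` N /\
  forall U, ub_cover L U ->
    exists2 K, weakly_bounded L K & star A U `<=` N `|` K.

End LargeScale.

(* The empty set gets diameter -oo and an unbounded set +oo, so that
   [diam A < e%:E] holds for empty A and fails for unbounded A. *)
Definition diam {R : realType} {M : metricType R} (A : set M) : \bar R :=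
  ereal_sup [set (mdist x y)%:E | x in A & y in A].

Definition slowly_oscillating {X : Type} (L : set (set (set X)))
    {R : realType} {M : metricType R} (f : X -> M) : Prop :=
  forall (U : set (set X)) (e : R), L U -> 0 < e ->
    exists2 K, weakly_bounded L K &
      forall A, U A -> A `&` K = set0 -> (diam (f @` A) < e%:E)%E.

(* [uniform_separatorP] turns [completely_regular_space] into separation of
   points from closed sets by continuous [0,1]-valued functions. *)
Definition tychonoff_space (T : topologicalType) : Prop :=
  hausdorff_space T /\ completely_regular_space T.

Section Hybrid.
Context {X : topologicalType}.
Implicit Types (A N V : set X) (L : set (set (set X))).

Definition hls_space L : Prop :=
  ls_structure L /\ exists2 U, ub_cover L U & U `<=` open.

Definition topological_nbhd A N : Prop :=
  exists O, [/\ open O, closure A `<=` O & O `<=` N].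

Definition hybrid_nbhd L A N : Prop :=
  coarse_nbhd L A N /\ topological_nbhd A N.

Definition hls_normal L : Prop :=
  forall A N, closed A -> hybrid_nbhd L A N ->
    exists V, [/\ closed V, hybrid_nbhd L A V & hybrid_nbhd L V N].

Definition topological_embedding {Y : topologicalType} (i : X -> Y) : Prop :=
  [/\ injective i, continuous i &
      forall O, open O -> exists2 W, open W & i @^-1` W = O].

Definition hausdorff_compactification {H : topologicalType} (i : X -> H) :
    Prop :=
  [/\ compact [set: H], hausdorff_space H, topological_embedding i
    & dense (range i)].

(* [R^o] carries the metric |y - x|.  The defining property determines [(H, i)]
   only up to homeomorphism under X: a compactification with this property is
   any model of h(X). *)
Definition higson_compactification (R : realType) L {H : topologicalType}
    (i : X -> H) : Prop :=
  hausdorff_compactification i /\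
  forall f : X -> R, continuous f -> range f `<=` `[0, 1] ->
    (exists g : H -> R,
       [/\ continuous g, range g `<=` `[0, 1] & g \o i = f])
    <-> slowly_oscillating L (f : X -> R^o).

End Hybrid.

(* Main.v *)
(* Disjoint closed sets A and B are coarsely separated iff the complement of B
   is a hybrid neighbourhood of A, and their closures in h(X) are disjoint iff
   some continuous slowly oscillating function to [0,1] is 0 on A and 1 on B
   (Urysohn's lemma in h(X)). Such a function always gives coarse separation;
   hls-normality supplies the converse through the dyadic construction of
   Urysohn's lemma, run with hybrid neighbourhoods: a member of a uniformly
   bounded family that avoids finitely many weakly bounded sets moves up by at
   most one dyadic level. Conversely, if N is a hybrid neighbourhood of A then
   so is its interior, and a function f separating A from the complement of
   the interior yields the intermediate closed set {f <= 1/2}. *)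
Require Import Defs.
From mathcomp Require Import all_boot all_order all_algebra.
From mathcomp Require Import all_classical all_reals all_analysis.
From mathcomp Require Import lra.

Local Open Scope classical_set_scope.

Import Order.TTheory GRing.Theory Num.Theory.
Import numFieldNormedType.Exports.

(** * Bounded sets, weakly bounded sets and coarse neighbourhoods *)

Section LargeScale.
Context {X : Type} {L : set (set (set X))}.
Hypothesis hL : ls_structure L.
Implicit Types (A B K N : set X) (U : set (set X)) (x y z : X).

Lemma star_subfamily A U1 U2 : U1 `<=` U2 -> star A U1 `<=` star A U2.
Proof.
by move=> U12 x [W [UW AW] Wx]; exists W => //; split=> //; exact: U12.
Qed.

Lemma ls_refine U1 U2 : L U1 ->
  (forall B, U2 B -> exists2 A, U1 A & B `<=` A) -> L U2.
Proof. by case: hL => _ h _ LU1 U12; apply: h LU1 _ => B /U12. Qed.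

(** The first axiom tests only members with two distinct points, so singletons come for free; they
    turn any uniformly bounded family into a cover. *)
Lemma ls_add_singletons U : L U -> L (U `|` range set1).
Proof.
case: hL => _ h _ LU; apply: (h _ _ LU) => B [UB _|[z _ <-]].
  by exists B.
by move=> [x [y [-> ->]]].
Qed.

Lemma ub_cover_add_singletons U : L U -> ub_cover L (U `|` range set1).
Proof.
move=> LU; split; first exact: ls_add_singletons.
by rewrite -subTset => x _; exists [set x] => //; right; exists x.
Qed.

(** Once singletons are added, a member of [U1] lies in its own star, and a member of [U2] lies in
    the star of any of its points. *)
Lemma ls_setU U1 U2 : L U1 -> L U2 -> L (U1 `|` U2).
Proof.
move=> LU1 LU2; case: (hL) => _ hi hii.
apply: hi (hii _ _ (ls_add_singletons _ LU1) (ls_add_singletons _ LU2)) _.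
move=> B [UB|UB] [x [_ [Bx _ _]]].
  exists (star B (U2 `|` range set1)); first by exists B => //; left.
  move=> y By; exists [set y] => //; split; first by right; exists y.
  by exists y.
exists (star [set x] (U2 `|` range set1)).
  by exists [set x] => //; right; exists x.
by move=> y By; exists B => //; split; [left|exists x].
Qed.

Lemma bounded_of_ls U B : L U -> U B -> bounded L B.
Proof.
by move=> LU UB; exists (U `|` range set1); [exact: ub_cover_add_singletons|left].
Qed.

Lemma bounded_subset A B : A `<=` B -> bounded L B -> bounded L A.
Proof.
move=> AB [U [LU _] UB]; apply: (@bounded_of_ls [set A]) => //.
by apply: (ls_refine _ _ LU) => _ ->; exists B.
Qed.

Lemma bounded_star U B : L U -> bounded L B -> bounded L (star B U).
Proof.
move=> LU [V [LV _] VB]; have [_ _ h] := hL.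
by apply: bounded_of_ls (h _ _ LV LU) _; exists B.
Qed.

Lemma bounded_setU A B :
  A `&` B !=set0 -> bounded L A -> bounded L B -> bounded L (A `|` B).
Proof.
move=> [z [Az Bz]] [U1 [LU1 _] UA] bB; have [U2 [LU2 _] UB] := bB.
apply: bounded_subset (bounded_star _ _ (ls_setU _ _ LU1 LU2) bB).
move=> x [Ax|Bx]; [exists A => //|exists B => //]; split=> //.
- by left.
- by exists z.
- by right.
- by exists z.
Qed.

Lemma coarse_component_refl x : coarse_component L x x.
Proof.
have [U LU] : L !=set0 by case: hL.
exists [set x] => //; split => //.
exists (U `|` range set1); first exact: ub_cover_add_singletons.
by right; exists x.
Qed.

Lemma coarse_component_sym x y :
  coarse_component L x y -> coarse_component L y x.
Proof. by move=> [B [bB Bx] By]; exists B. Qed.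

Lemma coarse_component_trans y x z : coarse_component L x y ->
  coarse_component L y z -> coarse_component L x z.
Proof.
move=> [B [bB Bx] By] [C [bC Cy] Cz]; exists (B `|` C); last by right.
by split; [apply: bounded_setU => //; exists y|left].
Qed.

Lemma weakly_bounded_subset A K :
  A `<=` K -> weakly_bounded L K -> weakly_bounded L A.
Proof. by move=> AK wK x; apply: bounded_subset (wK x); exact: setSI. Qed.

Lemma weakly_bounded_set0 : weakly_bounded L (set0 : set X).
Proof.
move=> x; rewrite set0I; have [B [bB _] _] := coarse_component_refl x.
exact: bounded_subset bB.
Qed.

(** If both sets meet the component, some bounded [C] joins a point of one trace to a point of the
    other, and a chain of overlapping bounded sets has bounded union. *)
Lemma weakly_bounded_setU A B :
  weakly_bounded L A -> weakly_bounded L B -> weakly_bounded L (A `|` B).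
Proof.
move=> wA wB x; rewrite setIUl.
have [->|/set0P[a [Aa xa]]] := eqVneq (A `&` coarse_component L x) set0.
  by rewrite set0U; exact: wB.
have [->|/set0P[b [Bb xb]]] := eqVneq (B `&` coarse_component L x) set0.
  by rewrite setU0; exact: wA.
have [C [bC Ca] Cb] :=
  coarse_component_trans _ _ _ (coarse_component_sym _ _ xa) xb.
apply: (@bounded_subset _
  ((A `&` coarse_component L x `|` C) `|` B `&` coarse_component L x)).
  by apply: setSU; exact: subsetUl.
apply: bounded_setU; [by exists b; split => //; right| |exact: wB].
by apply: bounded_setU; [by exists a|exact: wA|].
Qed.

(** Members of [U] never leave a coarse component, so the trace of the star lies in the star of the
    trace. *)
Lemma weakly_bounded_star K U :
  L U -> weakly_bounded L K -> weakly_bounded L (star K U).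
Proof.
move=> LU wK x; apply: bounded_subset (bounded_star _ _ LU (wK x)).
move=> y [[W [UW [k [Wk Kk]]] Wy] xy]; exists W => //; split=> //.
exists k; split => //; split=> //; apply: coarse_component_trans xy _.
by exists W => //; split=> //; exact: bounded_of_ls UW.
Qed.

Lemma coarse_nbhd_star {A N U} : coarse_nbhd L A N -> L U ->
  exists2 K, weakly_bounded L K & star A U `<=` N `|` K.
Proof.
move=> [_ h] LU; have [K wK AK] := h _ (ub_cover_add_singletons _ LU).
exists K => //; apply: subset_trans AK; apply: star_subfamily.
exact: subsetUl.
Qed.

Lemma coarsely_separatedE A B : A `&` B = set0 ->
  coarsely_separated L A B <-> coarse_nbhd L A (~` B).
Proof.
move=> AB0; split=> [sAB|AB U LU].
  split; first exact/disjoints_subset.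
  move=> U [LU cU]; exists (star A U `&` star B U); first exact: sAB.
  (* As [U] is a cover, a point of [B] also lies in [star B U]. *)
  move=> x Ax; have [Bx|] := pselect (B x); [right; split=> //|by left].
  have : cover U id x by rewrite cU.
  by move=> [W UW Wx]; exists W => //; split=> //; exists x.
have LUs := ls_add_singletons _ LU; have [_ _ hs] := hL.
(* A point b of B lying in a member of U that meets star A U belongs to
   the star of A with respect to the stars of U. *)
have [K wK AK] := coarse_nbhd_star AB (hs _ _ LU LU).
apply: weakly_bounded_subset (weakly_bounded_star _ _ LU wK).
move=> x [[W1 [UW1 [a [W1a Aa]]] W1x] [W2 [UW2 [b [W2b Bb]]] W2x]].
exists W2 => //; split => //; exists b; split=> //.
have : (~` B `|` K) b by apply: AK; exists (star W1 U);
  [split; [exists W1|exists a; split => //; exists W1 => //; split=> //; exists a]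
  |exists W2 => //; split => //; exists x].
by case.
Qed.

End LargeScale.

(** * Slow oscillation of real-valued functions *)

Section SlowOscillation.
Local Open Scope ring_scope.
Context {R : realType} {X : Type} {L : set (set (set X))}.
Hypothesis hL : ls_structure L.
Implicit Types (A B K N : set X) (U : set (set X)) (x y z : X) (f : X -> R).

Lemma slowly_oscillatingP f : slowly_oscillating L (f : X -> R^o) <->
  forall U (e : R), L U -> 0 < e -> exists2 K, weakly_bounded L K &
    forall W, U W -> W `&` K = set0 ->
      forall x y, W x -> W y -> f y < f x + e.
Proof.
split=> [sf U e LU e0|sf U e LU e0].
  have [K wK KU] := sf _ _ LU e0; exists K => // W UW WK0 x y Wx Wy.
  have xy : (`|f y - f x|%:E < e%:E)%E.
    apply: le_lt_trans (KU _ UW WK0); apply: ereal_sup_ubound.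
    exists (f x) => /=; first by exists x.
    by exists (f y); first by exists y.
  by move: xy; rewrite lte_fin ltr_norml ltrBlDl => /andP[].
(* Halving [e] keeps the diameter, a supremum, strictly below [e]. *)
have e20 : 0 < e / 2 by rewrite divr_gt0.
have [K wK KU] := sf _ _ LU e20; exists K => // W UW WK0.
apply: (@le_lt_trans _ _ (e / 2)%:E); last first.
  by rewrite lte_fin ltr_pdivrMr// mulr_natr mulr2n ltrDl.
apply: ge_ereal_sup => _ [_ [x Wx <-] [_ [y Wy <-] <-]].
rewrite lee_fin [mdist _ _]/(`|_ - _|) ler_norml lerBlDl lerBrDl.
rewrite (ltW (KU _ UW WK0 _ _ Wx Wy)) andbT.
by rewrite lerBlDr (ltW (KU _ UW WK0 _ _ Wy Wx)).
Qed.

(** Take oscillation below [t - s] off [K]: a member meeting [A] either stays under [t] or meets [K]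
    and falls into [star K U]. *)
Lemma slowly_oscillating_coarse_nbhd f (s t : R) A N :
  slowly_oscillating L (f : X -> R^o) -> s < t ->
  A `<=` [set x | f x <= s] -> [set x | f x < t] `<=` N -> coarse_nbhd L A N.
Proof.
move=> /slowly_oscillatingP sf st As tN; split.
  by move=> x /As fxs; apply: tN; exact: le_lt_trans st.
move=> U [LU _]; have [|K wK KU] := sf U (t - s) LU; first by rewrite subr_gt0.
exists (star K U); first exact: weakly_bounded_star.
move=> x [W [UW [a [Wa Aa]]] Wx].
have [WK0|/set0P WK] := eqVneq (W `&` K) set0; last by right; exists W.
left; apply: tN => /=; apply: lt_le_trans (KU _ UW WK0 _ _ Wa Wx) _.
by rewrite addrCA gerDl subr_le0; exact: As.
Qed.

End SlowOscillation.

(** * Interiors and hybrid neighbourhoods *)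

Section Hybrid.
Local Open Scope ring_scope.
Context {X : topologicalType} {L : set (set (set X))}.
Implicit Types (A B N : set X).

(* Enlarging along a uniformly bounded open cover shows that only a weakly
   bounded part of the star of A can lie in N minus its interior. *)
Lemma coarse_nbhd_interior A N : hls_space L ->
  coarse_nbhd L A N -> A `<=` N° -> coarse_nbhd L A N°.
Proof.
move=> [hL [V [LV cV] oV]] AN AN0; split=> // U [LU _]; have [_ _ hii] := hL.
have coverV x : exists2 W, V W & W x.
  by have : cover V id x by rewrite cV.
have [K wK AK] := coarse_nbhd_star hL AN (hii _ _ LU LV).
exists (star K V); first exact: weakly_bounded_star.
move=> x [W [UW [a [Wa Aa]]] Wx].
have [Nx|nNx] := pselect (N° x); [by left|right].
have [G VG Gx] := coverV x; exists G => //; split => //.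
(* If [G] missed [K], each [z] in [G] would lie in [N], because [star W V] contains both [a] and
   [z]; the open [G] would then put [x] in the interior. *)
apply: contrapT => GK; apply: nNx.
suff : G `<=` N° by exact.
rewrite -open_subsetE; last exact: oV.
move=> z Gz; have [G' VG' G'a] := coverV a.
have : (N `|` K) z.
  apply: AK; exists (star W V); last by exists G => //; split=> //; exists x.
  split; first by exists W.
  by exists a; split => //; exists G' => //; split => //; exists a.
by case=> // Kz; case: GK; exists z.
Qed.

Lemma topological_nbhd_interior A N : topological_nbhd A N -> closure A `<=` N°.
Proof.
by move=> [G [oG AG GN]]; apply: subset_trans AG _; rewrite -open_subsetE.
Qed.

Lemma slowly_oscillating_hybrid_nbhd (R : realType) (f : X -> R) (s t : R) A N :
  ls_structure L -> continuous f -> slowly_oscillating L (f : X -> R^o) ->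
  s < t -> A `<=` [set x | f x <= s] -> [set x | f x < t] `<=` N ->
  hybrid_nbhd L A N.
Proof.
move=> hL cf sf st As tN; split.
  exact: slowly_oscillating_coarse_nbhd st As tN.
exists (f @^-1` [set r | r < t]); split => //.
  by move/continuousP : cf; apply; exact: open_lt.
have /closure_id clE : closed (f @^-1` [set r | r <= s]).
  by apply: preimage_closed; [move=> x _; exact: cf|exact: closed_le].
move=> x /(closure_subset As); rewrite -clE.
by move=> /= /le_lt_trans; exact.
Qed.

End Hybrid.

(** * Dyadic chains and their Urysohn function *)

Section DyadicChain.
Local Open Scope ring_scope.
Context {X : Type}.
Implicit Types (A N V : set X) (F : nat -> nat -> set X).

(* [F n k] is the set attached to the dyadic number k / 2 ^ n. *)
Lemma dyadic_chain (P : set X -> set X -> Prop) A N :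
  (forall B M, P B M -> exists V, P B V /\ P V M) -> P A N ->
  exists F, [/\ F 0%N 0%N = A, F 0%N 1%N = N,
    forall n k, F n.+1 k.*2 = F n k &
    forall n k, (k < 2 ^ n)%N -> P (F n k) (F n k.+1)].
Proof.
move=> Pinterp PAN.
have /choice[mid midP] : forall BM : set X * set X, exists V,
    P BM.1 BM.2 -> P BM.1 V /\ P V BM.2.
  move=> [B M]; have [/Pinterp[V PV]|nP] := pselect (P B M); first by exists V.
  by exists set0 => /nP.
(* Even indices inherit the set of the previous level; odd ones interpolate between its two
   neighbours. *)
pose F := fix F n k := if n is n'.+1 then
    if odd k then mid (F n' k./2, F n' k./2.+1) else F n' k./2
  else if k == 0%N then A else N.
exists F; split=> //.
  by move=> n k /=; rewrite odd_double doubleK.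
elim=> [|n IHn] k kn; first by move: kn; rewrite expn0 ltnS leqn0 => /eqP ->.
have kn2 : (k./2 < 2 ^ n)%N.
  by rewrite -(ltn_pmul2l (isT : 0 < 2)%N) -expnS mul2n (leq_ltn_trans _ kn)//
    -[leqRHS]odd_double_half leq_addl.
have [P1 P2] := midP (F n k./2, F n k./2.+1) (IHn _ kn2).
rewrite /= uphalf_half; case: (odd k) => /=; first by rewrite add1n.
by rewrite add0n.
Qed.

(** Urysohn's function of the chain. The extra element [1] keeps the set nonempty and gives the
    value 1 to points outside the whole chain. *)
Definition dyadic_function {R : realType} F (x : X) : R :=
  inf [set r | r = 1 \/ exists n k, [/\ (k <= 2 ^ n)%N, F n k x &
                                      r = k%:R / 2 ^+ n]].

Context {R : realType} {F : nat -> nat -> set X}.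
Hypothesis F_double : forall n k, F n.+1 k.*2 = F n k.
Hypothesis F_succ : forall n k, (k < 2 ^ n)%N -> F n k `<=` F n k.+1.
Local Notation f := (@dyadic_function R F).

Lemma dyadic_chain_le n j k : (j <= k)%N -> (k <= 2 ^ n)%N -> F n j `<=` F n k.
Proof.
elim: k => [|k IHk]; first by rewrite leqn0 => /eqP -> _; exact: subset_refl.
rewrite leq_eqVlt => /orP[/eqP -> _|jk kn]; first exact: subset_refl.
by apply: subset_trans (F_succ _ _ kn); apply: IHk => //; exact: ltnW.
Qed.

Lemma dyadic_chain_scale m n k : F (m + n) (k * 2 ^ m) = F n k.
Proof.
elim: m => [|m IHm]; first by rewrite muln1.
by rewrite addSn expnS mulnCA mul2n F_double.
Qed.

Let lbound0 x : lbound [set r : R | r = 1 \/ exists n k,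
  [/\ (k <= 2 ^ n)%N, F n k x & r = k%:R / 2 ^+ n]] 0.
Proof. by move=> r [->//|[n [k [_ _ ->]]]]; rewrite divr_ge0. Qed.

Lemma dyadic_function_ge0 x : 0 <= f x.
Proof. by apply: lb_le_inf (lbound0 x); exists 1; left. Qed.

Lemma dyadic_function_le1 x : f x <= 1.
Proof. by apply: ge_inf; [exists 0; exact: lbound0|left]. Qed.

Lemma dyadic_function_le n k x : (k <= 2 ^ n)%N -> F n k x ->
  f x <= k%:R / 2 ^+ n.
Proof.
by move=> kn Fx; apply: ge_inf; [exists 0; exact: lbound0|right; exists n, k].
Qed.

Lemma dyadic_function_ge n k x : (k <= 2 ^ n)%N -> ~ F n k x ->
  k%:R / 2 ^+ n <= f x.
Proof.
move=> kn nFx; apply: lb_le_inf; first by exists 1; left.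
move=> _ [->|[m [j [jm Fx ->]]]].
  by rewrite ler_pdivrMr ?exprn_gt0// mul1r -natrX ler_nat.
(* A smaller [j / 2 ^ m] with [x] in [F m j] would, at the common level [m + n], force [x] into
   [F n k] by monotonicity. *)
rewrite leNgt; apply/negP.
rewrite ltr_pdivrMr ?exprn_gt0// mulrAC ltr_pdivlMr ?exprn_gt0//.
rewrite -!natrX -!natrM ltr_nat => jk; apply: nFx.
rewrite -(dyadic_chain_scale m).
apply: (@dyadic_chain_le _ (j * 2 ^ n)%N); first exact: ltnW.
  by rewrite expnD mulnC leq_mul2l kn orbT.
by rewrite addnC dyadic_chain_scale.
Qed.

(** Serves both continuity and slow oscillation. One unit of [2 / 2 ^+ n] comes from rounding [f x]
    up to the grid, the other from the move to the next level. *)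
Lemma dyadic_function_step n x y :
  (forall k, (k < 2 ^ n)%N -> F n k x -> F n k.+1 y) ->
  f y <= f x + 2 / 2 ^+ n.
Proof.
move=> Fxy; set k := Num.truncn (f x * 2 ^+ n).
have /andP[kx xk] : k%:R <= f x * 2 ^+ n < k.+1%:R.
  by apply: truncn_itv; rewrite mulr_ge0// dyadic_function_ge0.
apply: (@le_trans _ _ (k.+2%:R / 2 ^+ n)); last first.
  by rewrite ler_pdivrMr ?exprn_gt0// mulrDl divfK ?expf_neq0// -addn2 natrD lerD2r.
(* Past the top of the grid the bound [f y <= 1] already suffices. *)
have [kn|kn] := leqP k.+2 (2 ^ n); last first.
  apply: le_trans (dyadic_function_le1 _) _.
  by rewrite ler_pdivlMr ?exprn_gt0// mul1r -natrX ler_nat ltnW.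
apply: dyadic_function_le => //; apply: Fxy => //.
apply: contrapT => /(dyadic_function_ge _ _ _ (ltnW kn)).
by rewrite ler_pdivrMr ?exprn_gt0// leNgt xk.
Qed.

End DyadicChain.

(** * Separation by slowly oscillating functions *)

Section Separation.
Local Open Scope ring_scope.
Context {R : realType} {X : topologicalType} {L : set (set (set X))}.
Implicit Types (A B N : set X).

Definition slowly_oscillating_separation A B (f : X -> R) :=
  [/\ continuous f, range f `<=` `[0, 1], slowly_oscillating L (f : X -> R^o),
      A `<=` [set x | f x = 0] & B `<=` [set x | f x = 1]].

Lemma higson_separation (H : topologicalType) (i : X -> H) A B :
  higson_compactification R L i ->
  closure (i @` A) `&` closure (i @` B) = set0 <->
  exists f, slowly_oscillating_separation A B f.
Proof.
move=> [[cH hH [_ ci _] _] hi]; split=> [AB0|[f [cf f01 sf f0 f1]]].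
  have /(@normal_separatorP R) nH := compact_normal hH cH.
  have /(@uniform_separatorP _ R)[g [cg g01 g0 g1]] :=
    nH _ _ (@closed_closure _ _) (@closed_closure _ _) AB0.
  have ggi : range (g \o i) `<=` `[0, 1].
    by move=> _ [x _ <-]; apply: g01; exists (i x).
  have cgi : continuous (g \o i).
    by move=> x; apply: continuous_comp; [exact: ci|exact: cg].
  exists (g \o i); split => //.
  - by apply/(hi _ cgi ggi); exists g.
  - by move=> x Ax; apply: g0; exists (i x) => //; apply: subset_closure; exists x.
  - by move=> x Bx; apply: g1; exists (i x) => //; apply: subset_closure; exists x.
have [g [cg _ gif]] := (hi f cf f01).2 sf.
(* Fibres of [g] are closed, so a constant value on [C] persists on the closure in the
   compactification. *)
have gcst C r : C `<=` [set x | f x = r] ->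
    closure (i @` C) `<=` g @^-1` [set r].
  move=> fr; have /closure_id -> : closed (g @^-1` [set r]).
    by apply: preimage_closed; [move=> x _; exact: cg|exact: closed_eq].
  by apply: closure_subset => _ [x Cx <-] /=; rewrite -(fr _ Cx) -gif.
apply/seteqP; split=> // h [/(gcst _ _ f0) gh0 /(gcst _ _ f1) gh1].
have /eqP : (1 : R) = 0 by rewrite -gh0 -gh1.
by rewrite oner_eq0.
Qed.

Lemma hls_normal_separation A B : ls_structure L -> hls_normal L ->
  closed A -> closed B -> A `&` B = set0 -> coarsely_separated L A B ->
  exists f, slowly_oscillating_separation A B f.
Proof.
move=> hL nX clA clB AB0 sAB.
(* Only the inner set is required to be closed: the outermost set of the chain is the open
   complement of [B]. *)
pose P C N := closed C /\ hybrid_nbhd L C N.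
have PAB : P A (~` B).
  split=> //; split; first exact/coarsely_separatedE.
  exists (~` B); split => //; first exact: closed_openC.
  by rewrite -(closure_id A).1//; exact/disjoints_subset.
have Pinterp C N : P C N -> exists V, P C V /\ P V N.
  by move=> [clC CN]; have [V [clV CV VN]] := nX _ _ clC CN; exists V.
have [F [FA FB F_double PF]] := dyadic_chain P A (~` B) Pinterp PAB.
have F_succ n k : (k < 2 ^ n)%N -> F n k `<=` F n k.+1.
  by move=> /PF[_ [[]]].
pose f := @dyadic_function X R F.
have f_ge0 x : 0 <= f x by exact: dyadic_function_ge0.
have f_le1 x : f x <= 1 by exact: dyadic_function_le1.
have step := @dyadic_function_step X R F F_double F_succ.
have small (e : R) : 0 < e -> exists n, 2 / 2 ^+ n < e.
  move=> e0; have e20 : 0 < e / 2 by rewrite divr_gt0.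
  have [n _ /(_ n (leqnn n)) ne] := near_infty_natSinv_expn_lt (PosNum e20).
  by exists n; rewrite mulrC -ltr_pdivlMr// -div1r.
exists f; split.
- move=> x; apply/cvgrPdist_le => e /small[n ne].
  (* Finitely many conditions: if [x] is in [F n k], it is interior to [F n k.+1]; if [x] is outside
     [F n k.+1], it is outside the closure of [F n k]. *)
  have Fnear : \forall y \near x, forall k : 'I_(2 ^ n),
      (F n k x -> F n k.+1 y) /\ (F n k y -> F n k.+1 x).
    apply: filter_forall => k.
    have [_ [_ /topological_nbhd_interior kN]] := PF _ _ (ltn_ord k).
    apply: filterI.
      have [Fx|nFx] := pselect (F n k x).
        by apply: filterS (kN x (subset_closure Fx)) => y.
      by apply: filterE => y /nFx.
    have [Fx|nFx] := pselect (F n k.+1 x); first exact: filterE.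
    have : (~` F n k)° x.
      by rewrite interiorC => /kN/interior_subset.
    by apply: filterS => y nFy /nFy.
  apply: filterS Fnear => y Fxy.
  have xy : f x <= f y + 2 / 2 ^+ n.
    by apply: step => k kn; case: (Fxy (Ordinal kn)).
  have yx : f y <= f x + 2 / 2 ^+ n.
    by apply: step => k kn; case: (Fxy (Ordinal kn)).
  by rewrite ler_distl; lra.
- by move=> _ [x _ <-] /=; rewrite in_itv /= f_ge0 f_le1.
- apply/slowly_oscillatingP => U e LU /small[n ne].
  have [K wK KU] : exists2 K, weakly_bounded L K &
      forall k, (k < 2 ^ n)%N -> star (F n k) U `<=` F n k.+1 `|` K.
    (* Induction on the number [m] of levels treated, with [m <= 2 ^ n] kept as a hypothesis so that
       [PF] applies; [K] is a finite union of exceptional sets. *)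
    have : (2 ^ n <= 2 ^ n)%N by [].
    elim: {1 3}(2 ^ n)%N => [_|m IHm mn].
      by exists set0 => //; exact: weakly_bounded_set0.
    have [K wK KU] := IHm (ltnW mn).
    have [_ [cF _]] := PF _ _ mn.
    have [K' wK' KU'] := coarse_nbhd_star hL cF LU.
    exists (K `|` K'); first exact: weakly_bounded_setU.
    move=> k; rewrite ltnS leq_eqVlt => /orP[/eqP -> x /KU'|/KU h x /h].
      by case=> ?; [left|right; right].
    by case=> ?; [left|right; left].
  exists K => // W UW WK0 x y Wx Wy.
  apply: (@le_lt_trans _ _ (f x + 2 / 2 ^+ n)); last by rewrite ltrD2l.
  apply: step => k kn Fx.
  have /(KU _ kn)[//|Ky] : star (F n k) U y.
    by exists W => //; split => //; exists x.
  by have : (W `&` K) y by []; rewrite WK0.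
- move=> x; rewrite -FA => Fx; apply/eqP; rewrite eq_le f_ge0 andbT.
  by have := @dyadic_function_le X R F 0%N 0%N x (leq0n _) Fx; rewrite mul0r.
- move=> x Bx; apply/eqP; rewrite eq_le f_le1 /=.
  have nFx : ~ F 0%N 1%N x by rewrite FB.
  have := @dyadic_function_ge X R F F_double F_succ 0%N 1%N x (leqnn _) nFx.
  by rewrite expr0 divr1.
Qed.

End Separation.

Theorem proposition9p4 (R : realType) (X : topologicalType)
    (L : set (set (set X))) (hX : hls_space L) (tX : tychonoff_space X)
    (hoX : topologicalType) (i : X -> hoX)
    (hi : higson_compactification R L i) :
  hls_normal L <->
  (forall A B : set X, closed A -> closed B -> A `&` B = set0 ->
     (coarsely_separated L A B <->
      closure (i @` A) `&` closure (i @` B) = set0)).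
Proof.
have [hL _] := hX.
split=> [nX A B clA clB AB0|hAB A N clA [cAN tAN]].
  rewrite (higson_separation _ _ _ _ hi).
  split=> [|[f [cf _ sf f0 f1]]]; first exact: hls_normal_separation.
  apply/coarsely_separatedE => //.
  apply: (slowly_oscillating_coarse_nbhd hL _ _ _ _ _ sf (@ltr01 R)).
    by move=> x /f0 /= ->.
  by move=> x /= fx1 /f1 /= fx; rewrite fx ltxx in fx1.
have AN0 : A `<=` N°.
  by rewrite [X in X `<=` _](closure_id A).1//; exact: topological_nbhd_interior.
have AB0 : A `&` ~` N° = set0 by apply/disjoints_subset; rewrite setCK.
have sAB : coarsely_separated L A (~` N°).
  by apply/coarsely_separatedE => //; rewrite setCK; exact: coarse_nbhd_interior.
have clN : closed (~` N°) by apply: open_closedC; exact: open_interior.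
have [f [cf _ sf f0 f1]] :=
  (higson_separation _ _ _ _ hi).1 ((hAB _ _ clA clN AB0).1 sAB).
have half_gt0 : (0 < 2^-1 :> R)%R by rewrite invr_gt0.
have half_lt1 : (2^-1 < 1 :> R)%R by rewrite invf_lt1// ltr1n.
exists (f @^-1` [set r | r <= 2^-1]%R); split.
- by apply: preimage_closed; [move=> x _; exact: cf|exact: closed_le].
- apply: (slowly_oscillating_hybrid_nbhd _ _ _ _ _ _ hL cf sf half_gt0).
    by move=> x /f0 /= ->.
  by move=> x /ltW.
(* Off the interior of [N] the value is 1, so the set where [f] is below 1 lies in [N]. *)
- apply: (slowly_oscillating_hybrid_nbhd _ _ _ _ _ _ hL cf sf half_lt1) => //.
  move=> x /= fx1; apply: interior_subset; apply: contrapT => /f1 /= fx.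
  by rewrite fx ltxx in fx1.
Qed.
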